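(* Let $\mathbb{K}$ be a field of characteristic different from $2$. Every $3$-dimensional skew-symmetric $\mathbb{K}$-algebra $A=(V,\mu)$ is a Hom-Lie algebra; that is, there exists a nonzero linear map $f:V\to V$ such that $$\mu(\mu(x,y),f(z))+\mu(\mu(y,z),f(x))+\mu(\mu(z,x),f(y))=0\quad\text{for all } x,y,z\in V.$$
   Context: A skew-symmetric $\mathbb{K}$-algebra is a finite-dimensional $\mathbb{K}$-vector space $V$ with a bilinear map $\mu:V\times V\to V$ satisfying $\mu(X,Y)=-\mu(Y,X)$ for all $X,Y\in V$; no further identity is assumed. Such an algebra is a Hom-Lie algebra if there is a nonzero linear map $f:V\to V$ satisfying the Hom-Jacobi identity, i.e. the cyclic sum over $x,y,z$ of $\mu(\mu(x,y),f(z))$ vanishes for all $x,y,z\in V$. *)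

(* Defs.v *)
From mathcomp Require Import all_boot all_algebra.

Set Implicit Arguments.
Unset Strict Implicit.
Unset Printing Implicit Defensive.

Import GRing.Theory.
Local Open Scope ring_scope.

Definition skew_symmetric (K : fieldType) (V : vectType K)
    (mu : {bilinear V -> V -> V}) : Prop :=
  forall x y : V, mu x y = - mu y x.

Definition hom_jacobi (K : fieldType) (V : vectType K)
    (mu : {bilinear V -> V -> V}) (f : 'End(V)) : Prop :=
  forall x y z : V,
    mu (mu x y) (f z) + mu (mu y z) (f x) + mu (mu z x) (f y) = 0.

(* The twisting map is only required to be linear and nonzero: it need be
   neither multiplicative for [mu] nor invertible. *)
Definition is_hom_lie (K : fieldType) (V : vectType K)
    (mu : {bilinear V -> V -> V}) : Prop :=
  skew_symmetric mu /\ exists f : 'End(V), f <> 0 /\ hom_jacobi mu f.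

(* Main.v *)
(* The Hom-Jacobi expression J x y z of a skew-symmetric mu is cyclic and
   alternating, so in dimension 3 it is determined by J e1 e2 e3 for a basis
   (e1, e2, e3).  The linear map f with f e1 = mu e2 e3, f e2 = mu e3 e1 and
   f e3 = mu e1 e2 turns J e1 e2 e3 into a sum of terms mu w w, which vanish
   in characteristic different from 2.  If this f is zero then so is mu, and
   the identity map will do. *)

From HB Require Import structures.
Require Import Defs.
From mathcomp Require Import all_boot all_algebra.

Set Implicit Arguments.
Unset Strict Implicit.
Unset Printing Implicit Defensive.

Import GRing.Theory.
Local Open Scope ring_scope.

(** [g] is a bare function with a separate linearity proof, so that partial applications of [mu] and
    [J] fit. Once packed as a linear map, its kernel contains [X], hence the span. *)
Lemma linear_eq0_span (K : fieldType) (V W : vectType K) (X : seq V)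
    (g : V -> W) :
  linear g -> <<X>>%VS = fullv -> {in X, forall v, g v = 0} ->
  forall x, g x = 0.
Proof.
move=> g_lin spanX gX0 x.
pose G : {linear V -> W} :=
  HB.pack g (GRing.isLinear.Build K V W _ g g_lin).
have : (<<X>> <= lker (linfun G))%VS.
  by apply/span_subvP => v /gX0 gv0; rewrite memv_ker lfunE /= gv0.
by move/subvP/(_ x); rewrite spanX memvf memv_ker lfunE => /(_ isT)/eqP.
Qed.

Section SkewSymmetric.

Variables (K : fieldType) (V : vectType K) (mu : {bilinear V -> V -> V}).
Hypotheses (char2 : 2%N \notin [pchar K]) (mu_skew : skew_symmetric mu).

Lemma skew_symmetric_diag x : mu x x = 0.
Proof.
have two_neq0 : 2%:R != 0 :> K by move: char2; rewrite inE.
have : 2%:R *: mu x x == 0.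
  by rewrite scaler_nat mulr2n {1}mu_skew addNr.
by rewrite scaler_eq0 (negPf two_neq0) => /eqP.
Qed.

(** Linearity in each slot leaves nine pairs: three diagonal ones, the three given ones and their
    reversals. *)
Lemma skew_bilinear_eq0 (e1 e2 e3 : V) :
  <<[:: e1; e2; e3]>>%VS = fullv ->
  mu e1 e2 = 0 -> mu e2 e3 = 0 -> mu e3 e1 = 0 -> forall x y, mu x y = 0.
Proof.
move=> spanX mu12 mu23 mu31 x y.
apply: (linear_eq0_span (g := mu x) _ spanX) => [a u v|v Xv].
  exact: linearPr.
apply: (linear_eq0_span (g := mu^~ v) _ spanX) => [a u u'|u Xu].
  exact: linearPl.
move: Xu Xv; rewrite !inE => /or3P[]/eqP-> /or3P[]/eqP->;
  by rewrite ?skew_symmetric_diag ?mu12 ?mu23 ?mu31 // mu_skew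
             ?mu12 ?mu23 ?mu31 oppr0.
Qed.

Variable f : 'End(V).

Let J x y z := mu (mu x y) (f z) + mu (mu y z) (f x) + mu (mu z x) (f y).

Lemma hom_jacobi_rot x y z : J x y z = J y z x.
Proof. by rewrite /J -addrA addrC. Qed.

Lemma hom_jacobi_swap x y z : J y x z = - J x y z.
Proof.
rewrite /J [mu y x]mu_skew [mu x z]mu_skew [mu z y]mu_skew !linearNl /=.
by rewrite !opprD addrAC.
Qed.

Lemma hom_jacobi_diag x z : J x x z = 0.
Proof.
by rewrite /J skew_symmetric_diag linear0l add0r [mu x z]mu_skew linearNl addNr.
Qed.

Lemma hom_jacobi_linear y z : linear (fun x => J x y z).
Proof.
move=> a u v; rewrite /J linearPl /= linearPl /= linearP /= linearPr /=.
(* The right side lists the three multiples of [a] first; the permutation interleaves them with the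
   other terms as on the left. *)
by rewrite linearPr /= linearPl /= !scalerDr !addrA [RHS](ACl (1*4*2*5*3*6)).
Qed.

Lemma hom_jacobi_spanning_triple (e1 e2 e3 : V) :
  <<[:: e1; e2; e3]>>%VS = fullv -> J e1 e2 e3 = 0 -> hom_jacobi mu f.
Proof.
move=> spanX J123 x y z; rewrite -/(J x y z).
have ext u v : {in [:: e1; e2; e3], forall e, J e u v = 0} ->
    forall t, J t u v = 0.
  exact: linear_eq0_span (@hom_jacobi_linear u v) spanX.
(* [ext] acts on the first slot only; each rotation brings the next free variable there. *)
apply: (ext) => a Xa; rewrite hom_jacobi_rot.
apply: (ext) => b Xb; rewrite hom_jacobi_rot.
apply: (ext) => c Xc.
have J231 : J e2 e3 e1 = 0 by rewrite -hom_jacobi_rot.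
have J312 : J e3 e1 e2 = 0 by rewrite hom_jacobi_rot.
have diag13 u v : J u v u = 0 by rewrite -hom_jacobi_rot hom_jacobi_diag.
have diag23 u v : J v u u = 0 by rewrite hom_jacobi_rot hom_jacobi_diag.
move: Xa Xb Xc; rewrite !inE.
move=> /or3P[]/eqP-> /or3P[]/eqP-> /or3P[]/eqP->;
  rewrite ?hom_jacobi_diag ?diag13 ?diag23 ?J123 ?J231 ?J312 //;
  (* Only the three odd permutations of the triple remain; a swap makes them even. *)
  by rewrite hom_jacobi_swap ?J123 ?J231 ?J312 oppr0.
Qed.

End SkewSymmetric.

Theorem theorem17 (K : fieldType) (V : vectType K)
    (mu : {bilinear V -> V -> V}) :
  2%N \notin [pchar K] -> \dim {:V} = 3%N -> skew_symmetric mu ->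
  is_hom_lie mu.
Proof.
move=> char2 dimV mu_skew; split=> //.
have [e1 [e2 [e3 /andP[/eqP spanX freeX]]]] :
    exists e1 e2 e3 : V, basis_of fullv [:: e1; e2; e3].
  have size3 : size (vbasis {:V}) = 3%N by rewrite size_tuple.
  move: size3 (vbasisP {:V}).
  by case: (tval _) => [|e1 [|e2 [|e3 []]]] // _; exists e1, e2, e3.
have [g /(_ freeX erefl)[g1 g2 g3]] :=
  linear_of_free [:: e1; e2; e3] [:: mu e2 e3; mu e3 e1; mu e1 e2].
have [g0|/eqP g_neq0] := eqVneq (linfun g) 0; last first.
  exists (linfun g); split=> //.
  apply: (hom_jacobi_spanning_triple char2 mu_skew spanX).
  by rewrite !lfunE /= g1 g2 g3 !skew_symmetric_diag // !addr0.
have gE x : g x = 0 by rewrite -[g x]lfunE g0 lfunE.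
have mu0 : forall x y, mu x y = 0.
  by apply: (skew_bilinear_eq0 char2 mu_skew spanX);
    rewrite -?g1 -?g2 -?g3 gE.
exists \1%VF; split=> [id0|x y z]; last by rewrite !mu0 !addr0.
(* A vanishing identity would kill [e1], which is nonzero as a member of a free family. *)
have := free_not0 freeX (mem_head _ _).
by rewrite -[e1]id_lfunE id0 lfunE eqxx.
Qed.
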